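(* The quantum determinant $$\Gamma(u)=\mathrm{tr}_{12}\big(P^-_{12}\,(\mathsf K(u)\otimes\mathbb I)\,R^{(0)}\,(\mathbb I\otimes\mathsf K(uq))\big)$$ generates the center $\mathsf C^+$ of $\mathcal U_q^{T,+}$; that is, the coefficients of the expansion of $\Gamma(u)$ in powers of $u$ generate the subalgebra $\mathsf C^+$.
   Context: Notation: $\mathbb N=\{0,1,2,\dots\}$; base field $\mathbb C(q)$, $q$ an indeterminate; $[X,Y]=XY-YX$, $[X,Y]_q=qXY-q^{-1}YX$; $\bar\rho=q^{-1}(q^2-q^{-2})^2$, and $\bar k_\pm\in\mathbb C(q)$ satisfy $\bar\rho=\bar k_+\bar k_-(q+q^{-1})^2$. $\mathcal U_q^{T,+}$ is the unital associative $\mathbb C(q)$-algebra with generators $\{Y^+_{-k},Y^+_{k+1},Z^+_{k+1},\tilde Z^+_{k+1}\mid k\in\mathbb N\}$ and the following relations for all $k,\ell\in\mathbb N$: $[Y^+_1,Y^+_{-k}]=[Y^+_{k+1},Y^+_0]=\frac{Z^+_{k+1}-\tilde Z^+_{k+1}}{q+q^{-1}}$; $[Y^+_1,\tilde Z^+_{k+1}]_q=[Z^+_{k+1},Y^+_1]_q=\bar\rho\, Y^+_{k+2}$; $[\tilde Z^+_{k+1},Y^+_0]_q=[Y^+_0,Z^+_{k+1}]_q=\bar\rho\, Y^+_{-k-1}$; $[Y^+_{k+1},Y^+_{\ell+1}]=0$, $[Y^+_{-k},Y^+_{-\ell}]=0$; $[Y^+_{k+1},Y^+_{-\ell}]+[Y^+_{-k},Y^+_{\ell+1}]=0$;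 $[Y^+_{k+1},\tilde Z^+_{\ell+1}]+[\tilde Z^+_{k+1},Y^+_{\ell+1}]=0$; $[Y^+_{k+1},Z^+_{\ell+1}]+[Z^+_{k+1},Y^+_{\ell+1}]=0$; $[Y^+_{-k},\tilde Z^+_{\ell+1}]+[\tilde Z^+_{k+1},Y^+_{-\ell}]=0$; $[Y^+_{-k},Z^+_{\ell+1}]+[Z^+_{k+1},Y^+_{-\ell}]=0$; $[\tilde Z^+_{k+1},\tilde Z^+_{\ell+1}]=0$, $[Z^+_{k+1},Z^+_{\ell+1}]=0$; $[Z^+_{k+1},\tilde Z^+_{\ell+1}]+[\tilde Z^+_{k+1},Z^+_{\ell+1}]=0$. The center $\mathsf C^+$ is the subalgebra of $\mathcal U_q^{T,+}$ generated by the elements ($n\in\mathbb N$) $$\mathsf C_{n+1}=(q^2-q^{-2})\sum_{k=0}^nq^{-2n+2k-1}Y^+_{k+1}Y^+_{-n+k}-\frac{q-q^{-1}}{\bar\rho}\sum_{k=0}^{n+1}q^{2k-2n-2}Z^+_k\tilde Z^+_{n+1-k},$$ with $Z^+_0=\tilde Z^+_0=\bar\rho/(q-q^{-1})$. Generating functions, with $U=qu^2/(q+q^{-1})$: $\mathsf Y_+(u)=\sum_{k\in\mathbb N}Y^+_{k+1}U^{-k-1}$, $\mathsf Y_-(u)=\sum_{k\in\mathbb N}Y^+_{-k}U^{-k-1}$, $\mathsf Z_+(u)=\sum_{k\in\mathbb N}\tilde Z^+_{k+1}U^{-k-1}$, $\mathsf Z_-(u)=\sum_{k\in\mathbb N}Z^+_{k+1}U^{-k-1}$.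 The K-operator is $$\mathsf K(u)=\begin{pmatrix}uq\,\mathsf Y_+(u)&\frac{1}{\bar k_-(q+q^{-1})}\mathsf Z_+(u)+\frac{\bar k_+(q+q^{-1})}{q-q^{-1}}\\ \frac{1}{\bar k_+(q+q^{-1})}\mathsf Z_-(u)+\frac{\bar k_-(q+q^{-1})}{q-q^{-1}}&uq\,\mathsf Y_-(u)\end{pmatrix}.$$ $R^{(0)}=\mathrm{diag}(1,q^{-1},q^{-1},1)$ on $\mathbb C^2\otimes\mathbb C^2$, $P$ is the permutation operator of $\mathbb C^2\otimes\mathbb C^2$, $P^-_{12}=(1-P)/2$, $\mathrm{tr}_{12}$ is the trace over $\mathbb C^2\otimes\mathbb C^2$, and $\mathbb I$ is the $2\times2$ identity. *)

(* Defs.v *)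
From HB Require Import structures.
From mathcomp Require Import all_boot all_order all_algebra.
From mathcomp Require Import all_classical all_reals.
From mathcomp Require Import complex mxtens.
From mathcomp Require Import zify.
(* The notations of [monalg] clash with those of mathcomp-analysis. *)
From mathcomp Require Import -(notations) monalg.

Set Implicit Arguments.
Unset Strict Implicit.
Unset Printing Implicit Defensive.

Import Order.TTheory GRing.Theory Num.Theory.

Local Open Scope classical_set_scope.
Local Open Scope ring_scope.
Local Open Scope quotient_scope.

Definition subalg_gen {K : fieldType} {A : algType K} (S : set A) : set A :=
  smallest (fun B : set A => GRing.subalg_closed [in B]) S.

(* The quotient of an algebra by the two-sided ideal generated by the
   differences x - y with rel x y. *)
Section AlgebraQuotient.
Context {K : fieldType} {A : algType K} (rel : A -> A -> Prop).

Inductive ideal_gen : A -> Prop :=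
| ideal_gen0 : ideal_gen 0
| ideal_genD x y : ideal_gen x -> ideal_gen y -> ideal_gen (x + y)
| ideal_genM a b x y : rel x y -> ideal_gen (a * (x - y) * b).

Definition ideal_pred : {pred A} := fun x => `[< ideal_gen x >].

Lemma ideal_predP x : reflect (ideal_gen x) (x \in ideal_pred).
Proof. exact: asboolP. Qed.

Lemma ideal_predMl a x : x \in ideal_pred -> a * x \in ideal_pred.
Proof.
move=> /ideal_predP xI; apply/ideal_predP; elim: xI.
- by rewrite mulr0; exact: ideal_gen0.
- by move=> y z _ Iy _ Iz; rewrite mulrDr; exact: ideal_genD.
- by move=> c d y z yz; rewrite !mulrA; exact: (ideal_genM _ _ yz).
Qed.

Lemma ideal_predMr a x : x \in ideal_pred -> x * a \in ideal_pred.
Proof.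
move=> /ideal_predP xI; apply/ideal_predP; elim: xI.
- by rewrite mul0r; exact: ideal_gen0.
- by move=> y z _ Iy _ Iz; rewrite mulrDl; exact: ideal_genD.
- by move=> c d y z yz; rewrite -(mulrA _ _ a); exact: (ideal_genM _ _ yz).
Qed.

Lemma ideal_pred_zmod : GRing.zmod_closed ideal_pred.
Proof.
split; first by apply/ideal_predP; exact: ideal_gen0.
move=> x y /ideal_predP xI yI; apply/ideal_predP; apply: ideal_genD => //.
by apply/ideal_predP; rewrite -mulN1r; exact: ideal_predMl.
Qed.

HB.instance Definition _ :=
  GRing.isZmodClosed.Build A ideal_pred ideal_pred_zmod.

Definition alg_quot of ~ ideal_gen 1 := Quotient.quot ideal_pred.

Context (proper : ~ ideal_gen 1).
Local Notation Q := (alg_quot proper).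

HB.instance Definition _ := GRing.Zmodule.on Q.

Definition quot_pi (x : A) : Q := \pi_(Quotient.quot ideal_pred) x.
Definition quot_repr (x : Q) : A := repr (x : Quotient.quot ideal_pred).

Definition quot_one : Q := quot_pi 1.
Definition quot_mul (x y : Q) : Q := quot_pi (quot_repr x * quot_repr y).
Definition quot_scale (c : K) (x : Q) : Q := quot_pi (c *: quot_repr x).

Lemma quot_piP x y : quot_pi x = quot_pi y <-> ideal_gen (x - y).
Proof.
split=> [/eqP|xy]; last apply/eqP.
  by rewrite -Quotient.idealrBE => /ideal_predP.
by rewrite -Quotient.idealrBE; exact/ideal_predP.
Qed.

Lemma quot_pi_rel x y : rel x y -> quot_pi x = quot_pi y.
Proof.
by move=> xy; apply/quot_piP; rewrite -[_ - _]mulr1 -[_ - _]mul1r; constructor.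
Qed.

Lemma quot_reprK x : quot_pi (quot_repr x) = x.
Proof. exact: reprK. Qed.

Lemma quot_piK x : quot_repr (quot_pi x) - x \in ideal_pred.
Proof. by apply/ideal_predP/quot_piP; exact: quot_reprK. Qed.

Lemma quot_piD : {morph quot_pi : x y / x + y}.
Proof. exact: raddfD. Qed.

Lemma quot_piM x y : quot_pi (x * y) = quot_mul (quot_pi x) (quot_pi y).
Proof.
apply/esym/quot_piP/ideal_predP.
rewrite -[X in X - _](subrK (x * quot_repr (quot_pi y))) -mulrBl -addrA -mulrBr.
by rewrite rpredD ?(ideal_predMl _ (quot_piK _)) ?(ideal_predMr _ (quot_piK _)).
Qed.

Lemma quot_piZ c x : quot_pi (c *: x) = quot_scale c (quot_pi x).
Proof.
apply/esym/quot_piP/ideal_predP; rewrite -scalerBr -mulr_algl.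
by rewrite ideal_predMl ?quot_piK.
Qed.

Lemma quot_mulA : associative quot_mul.
Proof.
move=> x y z; rewrite -[x]quot_reprK -[y]quot_reprK -[z]quot_reprK.
by rewrite -!quot_piM mulrA.
Qed.

Lemma quot_mul1r : left_id quot_one quot_mul.
Proof. by move=> x; rewrite -[x]quot_reprK -!quot_piM mul1r. Qed.

Lemma quot_mulr1 : right_id quot_one quot_mul.
Proof. by move=> x; rewrite -[x]quot_reprK -!quot_piM mulr1. Qed.

Lemma quot_mulDl : left_distributive quot_mul +%R.
Proof.
move=> x y z; rewrite -[x]quot_reprK -[y]quot_reprK -[z]quot_reprK.
by rewrite -quot_piD -!quot_piM mulrDl quot_piD.
Qed.

Lemma quot_mulDr : right_distributive quot_mul +%R.
Proof.
move=> x y z; rewrite -[x]quot_reprK -[y]quot_reprK -[z]quot_reprK.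
by rewrite -quot_piD -!quot_piM mulrDr quot_piD.
Qed.

Lemma quot_oner_neq0 : quot_one != 0.
Proof.
apply/eqP; rewrite (_ : 0 = quot_pi 0); last exact/esym/raddf0.
by move/quot_piP; rewrite subr0.
Qed.

HB.instance Definition _ := GRing.Zmodule_isNzRing.Build Q
  quot_mulA quot_mul1r quot_mulr1 quot_mulDl quot_mulDr quot_oner_neq0.

Lemma quot_scaleA a b x : quot_scale a (quot_scale b x) = quot_scale (a * b) x.
Proof. by rewrite -[x]quot_reprK -!quot_piZ scalerA. Qed.

Lemma quot_scale1 : left_id 1 quot_scale.
Proof. by move=> x; rewrite -[x]quot_reprK -!quot_piZ scale1r. Qed.

Lemma quot_scaleDr : right_distributive quot_scale +%R.
Proof.
move=> c x y; rewrite -[x]quot_reprK -[y]quot_reprK.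
by rewrite -quot_piD -!quot_piZ scalerDr quot_piD.
Qed.

Lemma quot_scaleDl x : {morph quot_scale^~ x : a b / a + b}.
Proof. by move=> a b; rewrite -[x]quot_reprK -!quot_piZ scalerDl quot_piD. Qed.

HB.instance Definition _ := GRing.Zmodule_isLmodule.Build K Q
  quot_scaleA quot_scale1 quot_scaleDr quot_scaleDl.

Lemma quot_scaleAl c (x y : Q) : c *: (x * y) = c *: x * y.
Proof.
rewrite -[x]quot_reprK -[y]quot_reprK.
by rewrite /GRing.scale /GRing.mul /= -!(quot_piM, quot_piZ) scalerAl.
Qed.

HB.instance Definition _ := GRing.Lmodule_isLalgebra.Build K Q quot_scaleAl.

Lemma quot_scaleAr c (x y : Q) : c *: (x * y) = x * (c *: y).
Proof.
rewrite -[x]quot_reprK -[y]quot_reprK.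
by rewrite /GRing.scale /GRing.mul /= -!(quot_piM, quot_piZ) scalerAr.
Qed.

HB.instance Definition _ := GRing.Lalgebra_isAlgebra.Build K Q quot_scaleAr.

Lemma quot_pi_zmod_morphism : zmod_morphism quot_pi.
Proof. exact: raddfB. Qed.

Lemma quot_pi_monoid_morphism : monoid_morphism quot_pi.
Proof. by split=> //; exact: quot_piM. Qed.

HB.instance Definition _ :=
  GRing.isZmodMorphism.Build A Q quot_pi quot_pi_zmod_morphism.
HB.instance Definition _ :=
  GRing.isMonoidMorphism.Build A Q quot_pi quot_pi_monoid_morphism.
HB.instance Definition _ := GRing.isScalable.Build K A Q *:%R quot_pi quot_piZ.

End AlgebraQuotient.

(* GYpos k, GYneg k, GZ k and GZt k stand for Y^+_{k+1}, Y^+_{-k}, Z^+_{k+1}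
   and \tilde Z^+_{k+1}; the same index shift is used throughout. *)
Inductive gen := GYpos of nat | GYneg of nat | GZ of nat | GZt of nat.

HB.instance Definition _ := gen_eqMixin gen.
HB.instance Definition _ := gen_choiceMixin gen.

Section FreeAlgebra.
Context {K : fieldType}.

Lemma malg_scaleAr c (x y : malg (fmonom gen) K) : c *: (x * y) = x * (c *: y).
Proof.
have mulC (g : malg (fmonom gen) K) :
    c *: g = g * mkmalgU (@monalg.one (fmonom gen)) c.
  rewrite malgM_def malgZ_def fgmulgU.
  by apply/eq_bigr => /= k _; rewrite mulm1 mulrC.
by rewrite (mulC y) mulrA -mulC.
Qed.

(* The free algebra on [gen], as the algebra of the free monoid. *)
Definition free_alg := malg (fmonom gen) K.

HB.instance Definition _ := GRing.Lalgebra.on free_alg.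
HB.instance Definition _ :=
  GRing.Lalgebra_isAlgebra.Build K free_alg malg_scaleAr.

Definition free_gen (g : gen) : free_alg := mkmalgU (fmu g) 1.

(* The augmentation, which sends every generator to 0. *)
Definition aug (x : free_alg) : K := mcoeff (@monalg.one (fmonom gen)) x.

Lemma augD : {morph aug : x y / x + y}.
Proof. exact: mcoeffD. Qed.

Lemma augN : {morph aug : x / - x}.
Proof. exact: mcoeffN. Qed.

Lemma augZ c x : aug (c *: x) = c * aug x.
Proof. exact: mcoeffZ. Qed.

Lemma augM : {morph aug : x y / x * y}.
Proof. exact: (rmorphM (mcoeff (@monalg.one (fmonom gen)))). Qed.

Lemma aug0 : aug 0 = 0.
Proof. exact: mcoeff0. Qed.

Lemma aug1 : aug 1 = 1.
Proof. exact: (rmorph1 (mcoeff (@monalg.one (fmonom gen)))). Qed.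

Lemma aug_gen g : aug (free_gen g) = 0.
Proof.
rewrite /aug /free_gen mcoeffU; case: eqP => // /(congr1 (@fmonom_val _)).
by rewrite fmuE fm1.
Qed.
End FreeAlgebra.

Section Relations.
Context {K : fieldType} (q : K).

(* This is \bar\rho. *)
Definition rho : K := q^-1 * (q ^+ 2 - q ^- 2) ^+ 2.

Context {A : algType K}.

Definition bracket (x y : A) : A := x * y - y * x.
Definition qbracket (x y : A) : A := q *: (x * y) - q^-1 *: (y * x).

Context (Yp Ym Z Zt : nat -> A).

Inductive UqT_rel : A -> A -> Prop :=
| UqT_rel1a k : UqT_rel (bracket (Yp 0) (Ym k)) ((q + q^-1)^-1 *: (Z k - Zt k))
| UqT_rel1b k : UqT_rel (bracket (Yp k) (Ym 0)) ((q + q^-1)^-1 *: (Z k - Zt k))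
| UqT_rel2a k : UqT_rel (qbracket (Yp 0) (Zt k)) (rho *: Yp k.+1)
| UqT_rel2b k : UqT_rel (qbracket (Z k) (Yp 0)) (rho *: Yp k.+1)
| UqT_rel3a k : UqT_rel (qbracket (Zt k) (Ym 0)) (rho *: Ym k.+1)
| UqT_rel3b k : UqT_rel (qbracket (Ym 0) (Z k)) (rho *: Ym k.+1)
| UqT_rel4a k l : UqT_rel (bracket (Yp k) (Yp l)) 0
| UqT_rel4b k l : UqT_rel (bracket (Ym k) (Ym l)) 0
| UqT_rel5 k l : UqT_rel (bracket (Yp k) (Ym l) + bracket (Ym k) (Yp l)) 0
| UqT_rel6 k l : UqT_rel (bracket (Yp k) (Zt l) + bracket (Zt k) (Yp l)) 0
| UqT_rel7 k l : UqT_rel (bracket (Yp k) (Z l) + bracket (Z k) (Yp l)) 0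
| UqT_rel8 k l : UqT_rel (bracket (Ym k) (Zt l) + bracket (Zt k) (Ym l)) 0
| UqT_rel9 k l : UqT_rel (bracket (Ym k) (Z l) + bracket (Z k) (Ym l)) 0
| UqT_rel10a k l : UqT_rel (bracket (Zt k) (Zt l)) 0
| UqT_rel10b k l : UqT_rel (bracket (Z k) (Z l)) 0
| UqT_rel11 k l : UqT_rel (bracket (Z k) (Zt l) + bracket (Zt k) (Z l)) 0.

Lemma UqT_rel_ker (f : A -> K) :
    {morph f : x y / x + y} -> {morph f : x / - x} -> f 0 = 0 ->
    (forall c x, f (c *: x) = c * f x) -> {morph f : x y / x * y} ->
    (forall k, f (Yp k) = 0) -> (forall k, f (Ym k) = 0) ->
    (forall k, f (Z k) = 0) -> (forall k, f (Zt k) = 0) ->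
  forall x y, UqT_rel x y -> f (x - y) = 0.
Proof.
move=> fD fN f0 fZ fM fYp fYm fZ0 fZt x y xy.
by case: xy => *; rewrite /bracket /qbracket
  !(fD, fN, fZ, fM, f0, fYp, fYm, fZ0, fZt, mulr0, mul0r, oppr0, addr0).
Qed.
End Relations.

Section Presentation.
Context {K : fieldType} (q : K).

Definition free_rel : free_alg -> free_alg -> Prop :=
  UqT_rel q (free_gen \o GYpos) (free_gen \o GYneg)
            (free_gen \o GZ) (free_gen \o GZt).

Lemma free_rel_proper : ~ ideal_gen free_rel 1.
Proof.
have augI x : ideal_gen free_rel x -> aug x = 0.
  elim=> [|y z _ Hy _ Hz|a b y z yz]; first exact: aug0.
    by rewrite augD Hy Hz addr0.
  suff Hyz : aug (y - z) = 0 by rewrite augM (augM a) Hyz mulr0 mul0r.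
  exact: UqT_rel_ker augD augN aug0 augZ augM
    (fun=> aug_gen _) (fun=> aug_gen _) (fun=> aug_gen _) (fun=> aug_gen _)
    _ _ yz.
by move=> /augI /eqP; rewrite aug1 oner_eq0.
Qed.

Definition UqT : algType K := alg_quot free_rel_proper.

Definition UqT_gen (g : gen) : UqT := quot_pi free_rel_proper (free_gen g).

Definition Ypos (k : nat) : UqT := UqT_gen (GYpos k).
Definition Yneg (k : nat) : UqT := UqT_gen (GYneg k).
Definition Zgen (k : nat) : UqT := UqT_gen (GZ k).
Definition Ztgen (k : nat) : UqT := UqT_gen (GZt k).

(* Z^+_k and \tilde Z^+_k for k >= 0, without the index shift. *)
Definition Zfull (k : nat) : UqT :=
  if k is k'.+1 then Zgen k' else (rho q / (q - q^-1))%:A.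
Definition Ztfull (k : nat) : UqT :=
  if k is k'.+1 then Ztgen k' else (rho q / (q - q^-1))%:A.

(* central_elt n is C_{n+1}; Yneg (n - k) is Y^+_{-n+k}. *)
Definition central_elt (n : nat) : UqT :=
  (q ^+ 2 - q ^- 2) *:
    \sum_(k < n.+1) q ^ (- 2 * n%:Z + 2 * k%:Z - 1) *: (Ypos k * Yneg (n - k))
  - ((q - q^-1) / rho q) *:
    \sum_(k < n.+2) q ^ (2 * k%:Z - 2 * n%:Z - 2) *: (Zfull k * Ztfull (n.+1 - k)).

(* C^+ is by definition the (unital) subalgebra generated by the C_{n+1}. *)
Definition center_UqT : set UqT := subalg_gen (range central_elt).
End Presentation.

Arguments central_elt {K} q n.
Arguments center_UqT {K} q.

Section Laurent.
Context {K : fieldType} {A : algType K}.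

(* Formal Laurent series in u^-1: the function m |-> f m stands for the sum of
   the f m u^m, with f m = 0 for m large. *)
Definition is_laurent : {pred int -> A} :=
  fun f => `[< exists N, forall m, (N < m)%R -> f m = 0 >].

Lemma is_laurentP (f : int -> A) :
  reflect (exists N, forall m, (N < m)%R -> f m = 0) (f \in is_laurent).
Proof. exact: asboolP. Qed.

Lemma is_laurent_submod : GRing.submod_closed is_laurent.
Proof.
split=> [|c f g /is_laurentP[M fM] /is_laurentP[N gN]]; apply/is_laurentP.
  by exists 0.
exists (Num.max M N) => m; rewrite gt_max => /andP[Mm Nm].
by rewrite !fctE fM// gN// scaler0 addr0.
Qed.

HB.instance Definition _ :=
  GRing.isSubmodClosed.Build K (int -> A) is_laurent is_laurent_submod.

Record laurent := Laurent { lcoef :> int -> A; _ : lcoef \in is_laurent }.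

HB.instance Definition _ := [isSub for lcoef].
HB.instance Definition _ := [Choice of laurent by <:].
HB.instance Definition _ := [SubChoice_isSubLmodule of laurent by <:].

Lemma lcoef_bound (f : laurent) : exists N, forall m, (N < m)%R -> f m = 0.
Proof. exact/is_laurentP/valP. Qed.

Lemma laurentP (f g : laurent) : (forall m, f m = g m) -> f = g.
Proof. by move=> fg; apply/val_inj/funext. Qed.

Lemma lcoefD (f g : laurent) m : (f + g) m = f m + g m.
Proof. by []. Qed.

Lemma lcoefZ c (f : laurent) m : (c *: f) m = c *: f m.
Proof. by []. Qed.

Lemma int_le_ex (M m : int) : m <= M -> exists n : nat, m = M - n%:Z.
Proof. by move=> mM; exists `|M - m|%N; lia. Qed.

(* Only finitely many terms are non-zero when f and g are Laurent series. *)
Definition conv (f g : int -> A) (m : int) : A :=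
  \sum_(i \in [set: int]) f i * g (m - i).

(* The top N coefficients of a series of degree at most a, as a polynomial
   in u^-1. *)
Definition lpoly (a : int) (N : nat) (f : int -> A) : {poly A} :=
  \poly_(k < N) f (a - k%:Z).

Lemma conv_poly (a b : int) (N n : nat) (f g : int -> A) :
  (forall m, (a < m)%R -> f m = 0) -> (forall m, (b < m)%R -> g m = 0) ->
  (n < N)%N -> conv f g (a + b - n%:Z) = (lpoly a N f * lpoly b N g)`_n.
Proof.
move=> fa gb nN; rewrite /conv.
rewrite (fsbigE [seq a - k%:Z | k <- iota 0 n.+1]) //; first last.
- move=> i _ iN; have [ai|ia] := ltP a i; first by rewrite fa // mul0r.
  have [d Hd] := int_le_ex ia.
  case: (ltnP n d) => [nd|dn]; last first.
    by case/negP: iN; apply/mapP; exists d; rewrite ?mem_iota.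
  by rewrite Hd gb ?mulr0 //; lia.
- by rewrite map_inj_uniq ?iota_uniq // => x y /=; lia.
rewrite (eq_bigl xpredT) => [|i]; last by rewrite in_setT.
rewrite big_map coefM -[RHS](big_mkord xpredT (fun j => _`_j * _`_(n - j))).
rewrite /index_iota subn0 !big_seq; apply: eq_bigr => k.
rewrite mem_iota => /andP[_ kn].
rewrite !coef_poly (leq_ltn_trans _ nN) // (leq_ltn_trans (leq_subr _ _) nN).
by congr (_ * g _); lia.
Qed.

Lemma conv_bound (a b : int) (f g : int -> A) :
  (forall m, (a < m)%R -> f m = 0) -> (forall m, (b < m)%R -> g m = 0) ->
  forall m, (a + b < m)%R -> conv f g m = 0.
Proof.
move=> fa gb m abm; apply: fsbig1 => i _.
have [ai|ia] := ltP a i; first by rewrite fa // mul0r.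
by rewrite gb ?mulr0 //; lia.
Qed.

Lemma lpoly_conv (a b : int) (N n : nat) (f g : int -> A) :
  (forall m, (a < m)%R -> f m = 0) -> (forall m, (b < m)%R -> g m = 0) ->
  (n < N)%N ->
  (lpoly (a + b) N (conv f g))`_n = (lpoly a N f * lpoly b N g)`_n.
Proof. by move=> fa gb nN; rewrite {1}/lpoly coef_poly nN; exact: conv_poly. Qed.

Lemma convA (f g h : laurent) : conv f (conv g h) = conv (conv f g) h.
Proof.
have [a fa] := lcoef_bound f; have [b gb] := lcoef_bound g.
have [c hc] := lcoef_bound h.
have fgb := conv_bound fa gb; have ghb := conv_bound gb hc.
apply/funext => m; have [mm|mm] := ltP (a + b + c) m.
  by rewrite (conv_bound fgb hc) // (conv_bound fa ghb) // addrA.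
have [n ->] := int_le_ex mm.
rewrite (conv_poly fgb hc (ltnSn n)) -[a + b + c]addrA.
rewrite (conv_poly fa ghb (ltnSn n)).
transitivity ((lpoly a n.+1 f * lpoly b n.+1 g * lpoly c n.+1 h)`_n).
  rewrite -mulrA !coefM; apply: eq_bigr => k _; congr (_ * _).
  by rewrite lpoly_conv // ltnS leq_subr.
rewrite !coefM; apply: eq_bigr => k _; congr (_ * _).
by rewrite lpoly_conv.
Qed.

Lemma conv_laurent (f g : laurent) : conv f g \in is_laurent.
Proof.
have [a fa] := lcoef_bound f; have [b gb] := lcoef_bound g.
by apply/is_laurentP; exists (a + b); exact: conv_bound.
Qed.

Definition laurent_mul (f g : laurent) : laurent := Laurent (conv_laurent f g).

Lemma lmono_laurent (n : int) (a : A) :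
  (fun m => if m == n then a else 0) \in is_laurent.
Proof. by apply/is_laurentP; exists n => m nm; rewrite gt_eqF. Qed.

(* The monomial a u^n. *)
Definition lmono (n : int) (a : A) : laurent := Laurent (lmono_laurent n a).

Definition laurent_one : laurent := lmono 0 1.

Lemma conv_monol n a (f : int -> A) m : conv (lmono n a) f m = a * f (m - n).
Proof.
rewrite /conv (fsbigE [:: n]) //=; last first.
  by move=> i _; rewrite inE => /negbTE ->; rewrite mul0r.
by rewrite big_cons big_nil in_setT addr0 eqxx.
Qed.

Lemma conv_monor n a (f : int -> A) m : conv f (lmono n a) m = f (m - n) * a.
Proof.
rewrite /conv (fsbigE [:: m - n]) //=; last first.
  move=> i _; rewrite inE => /negP H; case: eqP => [E|_]; last by rewrite mulr0.
  by case: H; apply/eqP; rewrite -E; lia.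
by rewrite big_cons big_nil in_setT addr0 opprB addrCA subrr addr0 eqxx.
Qed.

Lemma laurent_mulA : associative laurent_mul.
Proof. by move=> f g h; apply/val_inj; exact: convA. Qed.

Lemma laurent_mul1r : left_id laurent_one laurent_mul.
Proof. by move=> f; apply/laurentP => m; rewrite [LHS]conv_monol mul1r subr0. Qed.

Lemma laurent_mulr1 : right_id laurent_one laurent_mul.
Proof. by move=> f; apply/laurentP => m; rewrite [LHS]conv_monor mulr1 subr0. Qed.

Lemma lpolyD a N (f g : int -> A) :
  lpoly a N (fun m => f m + g m) = lpoly a N f + lpoly a N g.
Proof.
by apply/polyP => i; rewrite coefD !coef_poly; case: ifP; rewrite ?addr0.
Qed.

Lemma laurent_mulDl : left_distributive laurent_mul +%R.
Proof.
move=> f g h; have [a fa] := lcoef_bound f; have [b gb] := lcoef_bound g.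
have [c hc] := lcoef_bound h; pose d := Num.max a b.
have fd m : (d < m)%R -> f m = 0 by rewrite gt_max => /andP[/fa].
have gd m : (d < m)%R -> g m = 0 by rewrite gt_max => /andP[_ /gb].
have fgd m : (d < m)%R -> f m + g m = 0 by move=> dm; rewrite fd// gd// addr0.
apply/laurentP => m; rewrite lcoefD.
change (conv (fun m => f m + g m) h m = conv f h m + conv g h m).
have [mm|mm] := ltP (d + c) m.
  by rewrite (conv_bound fgd hc)// (conv_bound fd hc)// (conv_bound gd hc)// addr0.
have [n ->] := int_le_ex mm.
rewrite (conv_poly fgd hc (ltnSn n)) (conv_poly fd hc (ltnSn n)).
by rewrite (conv_poly gd hc (ltnSn n)) lpolyD mulrDl coefD.
Qed.

Lemma laurent_mulDr : right_distributive laurent_mul +%R.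
Proof.
move=> h f g; have [a fa] := lcoef_bound f; have [b gb] := lcoef_bound g.
have [c hc] := lcoef_bound h; pose d := Num.max a b.
have fd m : (d < m)%R -> f m = 0 by rewrite gt_max => /andP[/fa].
have gd m : (d < m)%R -> g m = 0 by rewrite gt_max => /andP[_ /gb].
have fgd m : (d < m)%R -> f m + g m = 0 by move=> dm; rewrite fd// gd// addr0.
apply/laurentP => m; rewrite lcoefD.
change (conv h (fun m => f m + g m) m = conv h f m + conv h g m).
have [mm|mm] := ltP (c + d) m.
  by rewrite (conv_bound hc fgd)// (conv_bound hc fd)// (conv_bound hc gd)// addr0.
have [n ->] := int_le_ex mm.
rewrite (conv_poly hc fgd (ltnSn n)) (conv_poly hc fd (ltnSn n)).
by rewrite (conv_poly hc gd (ltnSn n)) lpolyD mulrDr coefD.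
Qed.

Lemma laurent_oner_neq0 : laurent_one != 0.
Proof.
apply/eqP => /(congr1 (fun f : laurent => f 0)) /eqP.
by rewrite oner_eq0.
Qed.

HB.instance Definition _ := GRing.Zmodule_isNzRing.Build laurent
  laurent_mulA laurent_mul1r laurent_mulr1 laurent_mulDl laurent_mulDr
  laurent_oner_neq0.

Lemma lcoefM (f g : laurent) m :
  (f * g) m = \sum_(i \in [set: int]) f i * g (m - i).
Proof. by []. Qed.

Lemma lscaleE c (f : laurent) : c *: f = lmono 0 c%:A * f.
Proof.
by apply/laurentP => m; rewrite lcoefZ [RHS]conv_monol mulr_algl subr0.
Qed.

Lemma lscaleEr c (f : laurent) : c *: f = f * lmono 0 c%:A.
Proof.
by apply/laurentP => m; rewrite lcoefZ [RHS]conv_monor mulr_algr subr0.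
Qed.

Lemma laurent_scaleAl c (f g : laurent) : c *: (f * g) = c *: f * g.
Proof. by rewrite !lscaleE mulrA. Qed.

HB.instance Definition _ :=
  GRing.Lmodule_isLalgebra.Build K laurent laurent_scaleAl.

Lemma laurent_scaleAr c (f g : laurent) : c *: (f * g) = f * (c *: g).
Proof. by rewrite !lscaleEr mulrA. Qed.

HB.instance Definition _ :=
  GRing.Lalgebra_isAlgebra.Build K laurent laurent_scaleAr.

(* The substitution of c u for u. *)
Lemma lsubst_laurent (c : K) (f : laurent) :
  (fun m : int => c ^ m *: f m) \in is_laurent.
Proof.
have [N fN] := lcoef_bound f.
by apply/is_laurentP; exists N => m /fN ->; rewrite scaler0.
Qed.

Definition lsubst (c : K) (f : laurent) : laurent :=
  Laurent (lsubst_laurent c f).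

(* The series of the x k * (c u^2)^(-k-1), for k >= 0. *)
Lemma genfun_laurent (c : K) (x : nat -> A) :
  (fun m : int => \sum_(k < `|m|%N | m == - 2 * k.+1%:Z) c ^- k.+1 *: x k)
    \in is_laurent.
Proof.
apply/is_laurentP; exists 0 => m m0; rewrite big1 // => k /eqP mk.
have : m < 0 by rewrite [m]mk; lia.
by move/(lt_trans m0); rewrite ltxx.
Qed.

Definition genfun (c : K) (x : nat -> A) : laurent :=
  Laurent (genfun_laurent c x).
End Laurent.

Arguments laurent {K} A.

Section QuantumDeterminant.
Context {K : fieldType} (q kp km : K).

Local Notation L := (laurent (UqT q)).

(* U = Uc u^2. *)
Definition Uc : K := q / (q + q^-1).

Definition Yplus_series : L := genfun Uc (@Ypos K q).
Definition Yminus_series : L := genfun Uc (@Yneg K q).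
Definition Zplus_series : L := genfun Uc (@Ztgen K q).
Definition Zminus_series : L := genfun Uc (@Zgen K q).

(* The formal variable u. *)
Definition uvar : L := lmono 1 1.

(* The K-operator K(u); kp and km are \bar k_+ and \bar k_-. *)
Definition Kop : 'M[L]_2 :=
  \matrix_(i < 2, j < 2)
    match val i, val j with
    | 0%N, 0%N => q *: (uvar * Yplus_series)
    | 0%N, _ => (km * (q + q^-1))^-1 *: Zplus_series
                + (kp * (q + q^-1) / (q - q^-1))%:A
    | _, 0%N => (kp * (q + q^-1))^-1 *: Zminus_series
                + (km * (q + q^-1) / (q - q^-1))%:A
    | _, _ => q *: (uvar * Yminus_series)
    end.

(* K(uq). *)
Definition Kop_shift : 'M[L]_2 := map_mx (lsubst q) Kop.

Definition R0 : 'M[K]_(2 * 2) :=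
  diag_mx (\row_(i < 2 * 2) [:: 1; q^-1; q^-1; 1]`_i).

(* The flip of the two tensor factors. *)
Definition Pflip : 'M[K]_(2 * 2) :=
  \matrix_(i < 2 * 2, j < 2 * 2)
    (mxtens_unindex i == ((mxtens_unindex j).2, (mxtens_unindex j).1)
       :> 'I_2 * 'I_2)%:R.

Definition Pminus : 'M[K]_(2 * 2) := 2^-1 *: (1%:M - Pflip).

Definition Gamma : L :=
  \tr (map_mx (in_alg L) Pminus *m (Kop *t 1%:M) *m
       map_mx (in_alg L) R0 *m (1%:M *t Kop_shift)).
End QuantumDeterminant.

Arguments Kop {K} q kp km.
Arguments Kop_shift {K} q kp km.
Arguments Gamma {K} q kp km.

Section RationalFunctions.
Context (R : realType).

Definition Cq : fieldType := {fraction {poly R[i]}}.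
Definition qvar : Cq := tofrac 'X.
End RationalFunctions.

(* Main.v *)
Require Import Defs.
From mathcomp Require Import all_boot all_order all_algebra.
From mathcomp Require Import all_classical all_reals.
From mathcomp Require Import complex mxtens ring zify.
(* Writing K(u) = [[a, b], [g, d]], the trace defining Gamma(u) equals
     1/2 (q^-1 (a(u) d(uq) + d(u) a(uq)) - (b(u) g(uq) + g(u) b(uq))),
   which is the half-sum of D(u) = q^-1 a(u) d(uq) - g(u) b(uq) and of
   D'(u) = q^-1 d(u) a(uq) - b(u) g(uq).  Up to a constant term, D(u) is, by its
   very shape, a rescaled generating series of the C_(n+1), so everything
   reduces to D = D'.
   For this write x = Y_1, y = Y_0, w = q^-2, B_kl = [Y_(k+1), Y_(-l)] and
   A_ij = [Z_i, Zt_j].  The relation [x, Zt_k]_q = rho Y_(k+1) makes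
   Y_(k+1) Zt_l - w Zt_l Y_(k+1) symmetric in k and l, and
   Y_(k+1) Zt_(l+1) - Zt_(l+1) Y_(k+1) is symmetric by a defining relation.
   Multiplying both symmetries on the right by y and moving y to the left
   expresses Z_i Zt_j - Z_j Zt_i through differences of the B_kl, and
   Y_(k+1) Y_(-l) - Y_(l+1) Y_(-k) through differences of the A_ij. In the
   coefficients of D - D' these expressions are weighted by powers of w, and
   Abel summation makes them cancel. *)

Set Implicit Arguments.
Unset Strict Implicit.
Unset Printing Implicit Defensive.
Import Order.TTheory GRing.Theory Num.Theory.
Local Open Scope classical_set_scope.
Local Open Scope ring_scope.

(** * Linear combinations in a module over a field, by reflection *)

Inductive lin_expr (K : Type) : Type :=
  LinAtom of nat | LinZero | LinOpp of lin_expr K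
| LinAdd of lin_expr K & lin_expr K | LinScale of K & lin_expr K.
Arguments LinAtom {K}.
Arguments LinZero {K}.

Section LinExpr.
Context {K : fieldType} {V : lmodType K}.

Fixpoint lin_eval (v : seq V) (e : lin_expr K) : V :=
  match e with
  | LinAtom n => nth 0 v n
  | LinZero => 0
  | LinOpp e => - lin_eval v e
  | LinAdd e1 e2 => lin_eval v e1 + lin_eval v e2
  | LinScale c e => c *: lin_eval v e
  end.

Fixpoint lin_coef (e : lin_expr K) (i : nat) : K :=
  match e with
  | LinAtom n => if eqn n i then 1 else 0
  | LinZero => 0
  | LinOpp e => - lin_coef e i
  | LinAdd e1 e2 => lin_coef e1 i + lin_coef e2 i
  | LinScale c e => c * lin_coef e i
  end.

(** A recursive conjunction, so that [cbn] and [split] leave one closed scalar equation per atom. *)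
Fixpoint lin_same_coef (e1 e2 : lin_expr K) (n : nat) : Prop :=
  if n is n'.+1 then lin_coef e1 n' = lin_coef e2 n' /\ lin_same_coef e1 e2 n'
  else True.

Lemma lin_evalE v e : lin_eval v e = \sum_(i < size v) lin_coef e i *: v`_i.
Proof.
elim: e => /= [n||e ->|e1 -> e2 ->|c e ->].
- rewrite (eq_bigr (fun i : 'I__ => if n == i :> nat then v`_i else 0));
    last first.
    by move=> i _; rewrite eqnE; case: eqP => _; rewrite ?scale1r ?scale0r.
  rewrite -big_mkcond /=; have [nv|vn] := ltnP n (size v).
    by rewrite (big_pred1 (Ordinal nv)) // => i; rewrite -val_eqE eq_sym.
  rewrite nth_default // big_pred0 // => i.
  by apply/negbTE; rewrite neq_ltn orbC (leq_trans (ltn_ord i) vn).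
- by rewrite big1 // => i _; rewrite scale0r.
- by rewrite -sumrN; apply: eq_bigr => i _; rewrite scaleNr.
- by rewrite -big_split; apply: eq_bigr => i _; rewrite scalerDl.
- by rewrite scaler_sumr; apply: eq_bigr => i _; rewrite scalerA.
Qed.

Lemma lin_eval_eq v e1 e2 :
  lin_same_coef e1 e2 (size v) -> lin_eval v e1 = lin_eval v e2.
Proof.
rewrite !lin_evalE => H; apply: eq_bigr => -[i iv] _ /=; congr (_ *: _).
elim: (size v) H iv => // n IH [Hn /IH{}IH].
by rewrite ltnS leq_eqVlt => /predU1P[->|/IH].
Qed.
End LinExpr.

(* Atoms are compared up to conversion: the same product may be written with
   different canonical structure instances. *)
Ltac lin_index x v :=
  match v with
  | ?y :: _ => let _ := constr:(erefl : x = y) in constr:(0%N)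
  | _ :: ?v' => let n := lin_index x v' in constr:(S n)
  end.

Ltac lin_atoms t v :=
  lazymatch t with
  | GRing.add ?a ?b => let v' := lin_atoms a v in lin_atoms b v'
  | GRing.opp ?a => lin_atoms a v
  | GRing.scale _ ?a => lin_atoms a v
  | GRing.zero => v
  | _ => match v with
         | _ => let _ := lin_index t v in v
         | _ => constr:(t :: v)
         end
  end.

Ltac lin_reify K t v :=
  lazymatch t with
  | GRing.add ?a ?b =>
    let x := lin_reify K a v in
    let y := lin_reify K b v in constr:(@LinAdd K x y)
  | GRing.opp ?a => let x := lin_reify K a v in constr:(@LinOpp K x)
  | GRing.scale ?c ?a => let x := lin_reify K a v in constr:(@LinScale K c x)
  | GRing.zero => constr:(@LinZero K)
  | _ => let n := lin_index t v in constr:(@LinAtom K n)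
  end.

(* Leaves one scalar equation per atom, for [ring] or [field]. *)
Ltac lin_module K :=
  lazymatch goal with
  | |- @eq ?V ?a ?b =>
    let v := lin_atoms a (@nil V) in
    let v := lin_atoms b v in
    let x := lin_reify K a v in
    let y := lin_reify K b v in
    apply: (@lin_eval_eq K _ v x y); cbn [lin_same_coef lin_coef size eqn];
    do ?split
  end.
(** * The trace over the tensor square *)

Lemma big_mxtens (V : nmodType) m n (F : 'I_(m * n) -> V) :
  \sum_k F k = \sum_(i < m) \sum_(j < n) F (mxtens_index (i, j)).
Proof.
rewrite pair_big (reindex (@mxtens_index m n)) /=.
  by apply: eq_bigr => -[].
exists (@mxtens_unindex m n) => k _; first exact: mxtens_indexK.
exact: mxtens_unindexK.
Qed.

Lemma mxtrace_Pminus (K : fieldType) (A : algType K) (N : 'M[A]_(2 * 2)) :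
  \tr (map_mx (in_alg A) (@Pminus K) *m N) =
  2^-1 *: \sum_(i < 2) \sum_(j < 2)
    (N (mxtens_index (i, j)) (mxtens_index (i, j)) -
     N (mxtens_index (j, i)) (mxtens_index (i, j))).
Proof.
rewrite /mxtrace big_mxtens scaler_sumr; apply: eq_bigr => i _.
rewrite scaler_sumr; apply: eq_bigr => j _; rewrite mxE.
rewrite (eq_bigr (fun k => 2^-1 *:
    ((mxtens_index (i, j) == k)%:R * N k (mxtens_index (i, j)) -
     (k == mxtens_index (j, i))%:R * N k (mxtens_index (i, j))))); last first.
  move=> k _; rewrite -[k]mxtens_unindexK; case: (mxtens_unindex k) => k1 k2.
  rewrite !mxE !mxtens_indexK /= -scalerAl mul1r -scalerA; congr (_ *: _).
  rewrite !(can_eq (@mxtens_indexK 2 2)).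
  have -> : ((i, j) == (k2, k1)) = ((k1, k2) == (j, i)).
    by apply/eqP/eqP => -[-> ->].
  by rewrite scalerBl !scaler_nat !mulr_natl.
rewrite -scaler_sumr sumrB; congr (_ *: (_ - _)).
  rewrite (bigD1 (mxtens_index (i, j))) //= eqxx mul1r big1 ?addr0 // => k.
  by rewrite eq_sym => /negbTE->; rewrite mul0r.
rewrite (bigD1 (mxtens_index (j, i))) //= eqxx mul1r big1 ?addr0 // => k.
by move=> /negbTE->; rewrite mul0r.
Qed.

(** [X *t 1] fixes the second tensor index and [1 *t Y] the first, so [(k, j)] is the only
    intermediate index, and the scalar is the entry of [R0] there. *)
Lemma tens1_R0_1tensE (K : fieldType) (q : K) (A : algType K) (X Y : 'M[A]_2)
    (i j k l : 'I_2) :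
  ((X *t 1%:M) *m map_mx (in_alg A) (R0 q) *m (1%:M *t Y))
     (mxtens_index (i, j)) (mxtens_index (k, l)) =
  (if k == j then 1 else q^-1) *: (X i k * Y j l).
Proof.
rewrite /R0 map_diag_mx mul_mx_diag mxE big_mxtens.
rewrite (bigD1 k) //= [X in _ + X]big1 ?addr0 => [|k' k'k]; last first.
  rewrite big1 // => j' _.
  by rewrite [X in _ * X]tensmxE [X in _ * (X * _)]mxE (negbTE k'k) mul0r mulr0.
rewrite (bigD1 j) //= [X in _ + X]big1 ?addr0 => [|j' j'j]; last first.
  by rewrite !mxE !mxtens_indexK /= eq_sym (negbTE j'j) mulr0 !mul0r.
rewrite mxE tensmxE [X in _ * X]tensmxE !mxE !eqxx mulr1 mul1r.
have -> : [:: 1; q^-1; q^-1; 1]`_(mxtens_index (k, j)) =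
    if k == j then 1 else q^-1.
  by case: k j => -[|[|//]] ? [[|[|//]]].
by rewrite /= mulr_algr scalerAl.
Qed.

(** For [i = j] the two terms of [mxtrace_Pminus] coincide; in the mixed pairs the weight [q^-1]
    falls only on products of diagonal entries. *)
Lemma qdet_trace (K : fieldType) (q : K) (A : algType K) (X Y : 'M[A]_2) :
  \tr (map_mx (in_alg A) (@Pminus K) *m (X *t 1%:M) *m
       map_mx (in_alg A) (R0 q) *m (1%:M *t Y)) =
  2^-1 *: (q^-1 *: (X 0 0 * Y 1 1 + X 1 1 * Y 0 0) -
           (X 0 1 * Y 1 0 + X 1 0 * Y 0 1)).
Proof.
rewrite -!mulmxA [X in _ *m X]mulmxA mxtrace_Pminus !big_ord_recl !big_ord0.
rewrite !tens1_R0_1tensE /=.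
have -> : lift ord0 (ord0 : 'I_1) = 1 :> 'I_2 by apply/val_inj.
have -> : ord0 = 0 :> 'I_2 by [].
rewrite !scale1r; congr (_ *: _).
by lin_module K; ring.
Qed.

(** * Laurent series whose exponents have a fixed parity *)

Section EvenSeries.
Context {K : fieldType} {A : algType K}.
Implicit Types (f g : int -> A) (x y : nat -> A) (d e : int).

(* f is the sum of the x k u^(d - 2k), for k >= 0. *)
Definition even_series d x f :=
  (forall k : nat, f (d - 2 * k%:Z) = x k) /\
  (forall m, (forall k : nat, m != d - 2 * k%:Z) -> f m = 0).

Lemma even_seriesZ c d x f : even_series d x f ->
  even_series d (fun k => c *: x k) (fun m => c *: f m).
Proof. by case=> fx f0; split=> [k|m /f0->]; rewrite ?fx ?scaler0. Qed.

Lemma even_seriesD d x y f g : even_series d x f -> even_series d y g ->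
  even_series d (fun k => x k + y k) (fun m => f m + g m).
Proof.
case=> fx f0 [gy g0]; split=> [k|m mE]; first by rewrite fx gy.
by rewrite f0 // g0 // addr0.
Qed.

Lemma even_seriesB d x y f g : even_series d x f -> even_series d y g ->
  even_series d (fun k => x k - y k) (fun m => f m - g m).
Proof.
case=> fx f0 [gy g0]; split=> [k|m mE]; first by rewrite fx gy.
by rewrite f0 // g0 // subr0.
Qed.

Lemma even_seriesM d e x y f g : even_series d x f -> even_series e y g ->
  even_series (d + e) (fun n => \sum_(k < n.+1) x k * y (n - k)%N) (conv f g).
Proof.
case=> fx f0 [gy g0]; split=> [n|m mE]; last first.
  rewrite /conv fsbig1 // => i _.
  have [[k ik]|iE] := pselect (exists k : nat, i = d - 2 * k%:Z); last first.
    by rewrite f0 ?mul0r // => k; apply/eqP => ik; apply: iE; exists k.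
  rewrite [X in _ * X]g0 ?mulr0 // => l; apply/eqP => il.
  by move/negP: (mE (k + l)%N); apply; apply/eqP; lia.
(* For [k > n] the exponent [m - i] exceeds the top exponent [e] of [g], so only [k <= n]
   contribute. *)
rewrite /conv (fsbigE [seq d - 2 * k%:Z | k <- iota 0 n.+1]) //; first last.
- move=> i _ iN.
  have [[k ik]|iE] := pselect (exists k : nat, i = d - 2 * k%:Z); last first.
    by rewrite f0 ?mul0r // => k; apply/eqP => ik; apply: iE; exists k.
  rewrite [X in _ * X]g0 ?mulr0 // => l; apply/eqP => il.
  case/negP: iN; apply/mapP; exists k; rewrite ?mem_iota //; lia.
- by rewrite map_inj_uniq ?iota_uniq // => k l /=; lia.
rewrite (eq_bigl xpredT) => [|i]; last by rewrite in_setT.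
rewrite big_map -[RHS](big_mkord xpredT (fun k => x k * y (n - k)%N)).
rewrite /index_iota subn0 !big_seq; apply: eq_bigr => k.
rewrite mem_iota => /andP[_ kn]; rewrite fx; congr (_ * _).
by rewrite -gy; congr (g _); lia.
Qed.

Lemma even_series_genfun c x :
  even_series (-2) (fun k => c ^- k.+1 *: x k) (genfun c x).
Proof.
split=> [k|m mE] /=; last first.
  by rewrite big1 // => k /eqP mk; move/eqP: (mE k); case; lia.
(* [genfun] cuts its sum at [|m|], which is [2k + 2] here and so admits [k]. *)
have kb : (k < `|((-2) - 2 * k%:Z)%R|)%N by lia.
rewrite (bigD1 (Ordinal kb)) /=; last by apply/eqP; clear; lia.
rewrite big1 ?addr0 // => i /andP[/eqP ik /eqP[]]; apply/val_inj => /=.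
by move: (nat_of_ord i) ik; clear; lia.
Qed.

Lemma even_series_shift d x f : even_series (d - 2) x f ->
  even_series d (fun k => if k is k'.+1 then x k' else 0) f.
Proof.
case=> fx f0; split=> [[|k]|m mE].
- by apply: f0 => k; apply/eqP; lia.
- by rewrite -fx; congr (f _); lia.
by apply: f0 => k; move: (mE k.+1); apply: contra_neq => ->; lia.
Qed.

Lemma even_series_const c :
  even_series 0 (fun k => if k is 0%N then c%:A else 0) (c%:A : laurent A).
Proof.
split=> [[|k]|m mE]; rewrite lcoefZ //=; first by rewrite scaler0.
by move: (mE 0%N); rewrite subr0 => /negbTE ->; rewrite scaler0.
Qed.

Lemma even_series_uvar d x f : even_series d x f ->
  even_series (d + 1) x (conv (lmono 1 1) f).
Proof.
case=> fx f0; split=> [k|m mE]; rewrite conv_monol mul1r.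
  by rewrite -fx; congr (f _); lia.
by apply: f0 => k; move: (mE k); apply: contra_neq; lia.
Qed.

Lemma even_series_lsubst c d x (f : laurent A) : even_series d x f ->
  even_series d (fun k => c ^ (d - 2 * k%:Z) *: x k) (lsubst c f).
Proof.
case=> fx f0; split=> [k|m /f0 fm]; first by rewrite -fx.
by rewrite /= fm scaler0.
Qed.

Lemma even_series_ext d x y f : (forall k, x k = y k) ->
  even_series d x f -> even_series d y f.
Proof. by move=> /funext ->. Qed.
End EvenSeries.

(** * Consequences of the defining relations *)

(** The boundary terms vanish, and [f k.+1] collects [w^(m-k-1)] from one summand and [- w^(m-k)]
    from the preceding one. *)
Lemma abel_geometric (K : fieldType) (V : lmodType K) (w : K) (f : nat -> V) m :
  f 0%N = 0 -> f m.+1 = 0 ->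
  \sum_(i < m.+1) w ^+ (m - i) *: (f i - f i.+1) =
  (1 - w) *: \sum_(k < m) w ^+ (m - k.+1) *: f k.+1.
Proof.
move=> f0 fm.
under eq_bigr do rewrite scalerBr.
rewrite sumrB big_ord_recl f0 scaler0 add0r big_ord_recr /= fm scaler0 addr0.
rewrite scalerBl scale1r scaler_sumr; congr (_ - _); apply: eq_bigr => k _.
by rewrite scalerA -exprS -subSn ?subSS.
Qed.

Lemma eq_by_sub (V : zmodType) (a b x y : V) : x = y -> a - b = x - y -> a = b.
Proof. by move=> ->; rewrite subrr => /eqP; rewrite subr_eq0 => /eqP. Qed.

(** * Non-vanishing of the scalars to be inverted *)

Section QuantumParameter.
Context {K : fieldType} (q : K).
Hypothesis q_neq0 : q != 0.

Lemma sqr_sub1_neq0 : q - q^-1 != 0 -> q * q - 1 != 0.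
Proof.
by rewrite (_ : q * q - 1 = q * (q - q^-1)); [exact: mulf_neq0|field].
Qed.

Lemma sqr_add1_neq0 : q + q^-1 != 0 -> q * q + 1 != 0.
Proof.
by rewrite (_ : q * q + 1 = q * (q + q^-1)); [exact: mulf_neq0|field].
Qed.

Lemma rho_neq0 : q + q^-1 != 0 -> q - q^-1 != 0 -> rho q != 0.
Proof.
move=> hp hm.
rewrite /rho (_ : q ^+ 2 - q ^- 2 = (q + q^-1) * (q - q^-1)); last by field.
by rewrite !(mulf_neq0, expf_neq0) ?invr_eq0.
Qed.
End QuantumParameter.

(* P k, M k, Z k and T k stand for Y^+_{k+1}, Y^+_{-k}, Z^+_k and
   \tilde Z^+_k; the last two are not shifted, so that the scalars Z^+_0 and
   \tilde Z^+_0 satisfy the same relations as the generators. *)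
Section HalfDeterminants.
Context {K : fieldType} {A : algType K} (q : K) (P M Z T D : nat -> A).
Local Notation h := (q + q^-1).
Local Notation w := (q ^- 2).
Hypotheses (q_neq0 : q != 0) (h_neq0 : h != 0) (qm_neq0 : q - q^-1 != 0).
Hypotheses (Z0 : Z 0 = (rho q / (q - q^-1))%:A)
           (T0 : T 0 = (rho q / (q - q^-1))%:A).
Hypothesis DE : forall k, D k = h^-1 *: (Z k.+1 - T k.+1).
Hypothesis PT : forall k, qbracket q (P 0) (T k) = rho q *: P k.
Hypothesis TM : forall k, qbracket q (T k) (M 0) = rho q *: M k.
Hypothesis PM0 : forall k, bracket (P k) (M 0) = D k.
Hypothesis P0M : forall k, bracket (P 0) (M k) = D k.
Hypothesis PMC : forall k l, bracket (P k) (M l) = bracket (P l) (M k).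
Hypothesis PTC : forall k l, bracket (P k) (T l.+1) = bracket (P l) (T k.+1).
Hypothesis TTC : forall k l, T k * T l = T l * T k.
Hypothesis ZTC : forall k l, bracket (Z k) (T l) = bracket (Z l) (T k).

Let w_neq1 : 1 - w != 0.
Proof.
have -> : 1 - w = (q * q - 1) / q ^+ 2 by field.
by rewrite mulf_neq0 ?sqr_sub1_neq0 ?invr_eq0 ?expf_eq0.
Qed.

Let rho_q_neq0 : rho q != 0 := rho_neq0 q_neq0 h_neq0 qm_neq0.

(* What moving [M 0] from right to left across [P k T l - c T l P k] adds. *)
Let G c k l := w *: (D k * T l) - c *: (T l * D k)
  + (q^-1 * rho q) *: (P k * M l - c *: (M l * P k)).

(** [T l] passes [M 0] with factor [w] and correction [q^-1 rho M l], and [P k] passes it with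
    correction [D k]. Whenever the left factor is symmetric in its indices, the terms starting with
    [M 0] cancel and leave a symmetry of [G]. *)
Lemma qcomm_PT_mulM c k l :
  (P k * T l - c *: (T l * P k)) * M 0 =
  w *: (M 0 * (P k * T l - c *: (T l * P k))) + G c k l.
Proof.
have TMl : T l * M 0 = w *: (M 0 * T l) + (q^-1 * rho q) *: M l.
  by rewrite -scalerA -TM /qbracket; lin_module K; field.
have PMk : P k * M 0 = M 0 * P k + D k by rewrite -PM0 addrC subrK.
have PTM : P k * T l * M 0 =
    w *: (M 0 * (P k * T l)) + w *: (D k * T l) + (q^-1 * rho q) *: (P k * M l).
  rewrite -mulrA TMl mulrDr -!scalerAr (mulrA (P k)) PMk mulrDl scalerDr.
  by rewrite -[M 0 * P k * _]mulrA.
have TPM : T l * P k * M 0 =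
    w *: (M 0 * (T l * P k)) + (q^-1 * rho q) *: (M l * P k) + T l * D k.
  rewrite -mulrA PMk mulrDr (mulrA (T l)) TMl mulrDl -!scalerAl.
  by rewrite -[M 0 * T l * _]mulrA.
rewrite mulrBl -scalerAl PTM TPM mulrBr -scalerAr /G.
by lin_module K; ring.
Qed.

Lemma G1C k l : G 1 k l.+1 = G 1 l k.+1.
Proof.
have := qcomm_PT_mulM 1 k l.+1; rewrite scale1r -/(bracket _ _) PTC.
have := qcomm_PT_mulM 1 l k.+1; rewrite scale1r -/(bracket _ _) => -> /addrI.
by [].
Qed.

(** Replacing [rho P i] by [[P 0, T i]_q] leaves words in [P 0] and two [T]s. The weight [w] gives
    [T i * P 0 * T j] and [T j * P 0 * T i] the same coefficient [- q^-1]; the other words are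
    symmetric because the [T]s commute. *)
Lemma qcomm_PTC k l :
  P k * T l - w *: (T l * P k) = P l * T k - w *: (T k * P l).
Proof.
have scaledE i j : rho q *: (P i * T j - w *: (T j * P i)) =
    q *: (P 0 * (T i * T j)) - q^-1 *: (T i * P 0 * T j)
    - w *: (q *: (T j * P 0 * T i) - q^-1 *: (T j * T i * P 0)).
  transitivity (rho q *: P i * T j - w *: (T j * (rho q *: P i))).
    by rewrite -scalerAl -scalerAr; lin_module K; ring.
  rewrite -PT /qbracket mulrBl mulrBr -!scalerAl -!scalerAr !mulrA.
  by lin_module K; ring.
apply: (scalerI rho_q_neq0); rewrite !scaledE (TTC l k).
by lin_module K; field.
Qed.

Lemma GwC k l : G w k l = G w l k.
Proof.
by have := qcomm_PT_mulM w k l; rewrite qcomm_PTC qcomm_PT_mulM => /addrI.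
Qed.

(** Expand [D] in [G1C]: the products of two [T]s cancel, and [ZTC] turns the difference of the
    [T Z] products into that of the [Z T] products, whence the factor [1 - w]. *)
Lemma ZT_antisymSS k l :
  (1 - w) *: (Z k.+1 * T l.+1 - Z l.+1 * T k.+1) =
  (q^-1 * rho q * h) *: (bracket (P k) (M l.+1) - bracket (P k.+1) (M l)).
Proof.
have ZTkl : T l.+1 * Z k.+1 =
    T k.+1 * Z l.+1 + Z k.+1 * T l.+1 - Z l.+1 * T k.+1.
  have /eqP := ZTC k.+1 l.+1; rewrite /bracket subr_eq => /eqP ->.
  by lin_module K; ring.
have /(congr1 (fun v => - (h *: v))) := G1C k l.
rewrite /G !DE !scale1r -!/(bracket _ _) (PMC l k.+1) -!scalerAl -!scalerAr.
rewrite !mulrBl !mulrBr (TTC k.+1) ZTkl => /eq_by_sub; apply.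
by lin_module K; field; rewrite ?q_neq0 ?sqr_sub1_neq0 ?sqr_add1_neq0.
Qed.

(** In [GwC] the [D] terms form commutators, and [P k M l - w M l P k = (1 - w) P k M l + w
    [P k, M l]], whose bracket is symmetric by [PMC] and drops out. *)
Lemma PM_antisym k l :
  ((1 - w) * (q^-1 * rho q * h)) *: (P k * M l - P l * M k) =
  w *: (bracket (Z k) (T l.+1) - bracket (Z k.+1) (T l)).
Proof.
have MPE i j : M j * P i = P i * M j - bracket (P i) (M j).
  by rewrite /bracket subKr.
have TDE i j : T j * D i = D i * T j - h^-1 *: bracket (Z i.+1) (T j).
  rewrite DE -scalerAl -scalerAr mulrBl mulrBr (TTC i.+1) /bracket.
  by lin_module K; ring.
have /(congr1 (fun v => h *: v)) := GwC k l.
rewrite /G !TDE !MPE (ZTC l.+1) (PMC l) => /eq_by_sub; apply.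
by lin_module K; field; rewrite ?q_neq0 ?sqr_sub1_neq0 ?sqr_add1_neq0.
Qed.

(** The zeros of [f] at both ends let one telescoping formula cover every [i]. At [i = 0] and
    [i = n.+1] scalars enter, and [1 - w = q^-1 (q - q^-1)] matches them with [D n = [P 0, M n] =
    [P n, M 0]]. *)
Lemma ZT_antisym n (i : 'I_n.+2) :
  let f j := if j is k.+1 then if (k <= n)%N then
    (q^-1 * rho q * h) *: bracket (P k) (M (n - k)) else 0 else 0 in
  (1 - w) *: (Z i * T (n.+1 - i) - Z (n.+1 - i) * T i) = f i - f i.+1.
Proof.
case: i => -[|k] /= kn.
  rewrite !subn0 P0M DE Z0 T0 mulr_algl mulr_algr.
  by lin_module K; field; rewrite ?q_neq0 ?sqr_sub1_neq0 ?sqr_add1_neq0.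
have [->|nk] := eqVneq k n.
  rewrite !subnn leqnn ltnn PM0 DE Z0 T0 mulr_algl mulr_algr.
  by lin_module K; field; rewrite ?q_neq0 ?sqr_sub1_neq0 ?sqr_add1_neq0.
rewrite subSS; have {}nk : (k < n)%N by rewrite ltn_neqAle nk -ltnS.
by rewrite nk ltnW // -(subnSK nk) ZT_antisymSS -scalerBr.
Qed.

Lemma sum_ZT_antisym n :
  \sum_(i < n.+2) w ^+ (n.+1 - i) *: (Z i * T (n.+1 - i) - Z (n.+1 - i) * T i) =
  (q^-1 * rho q * h) *:
    \sum_(k < n.+1) w ^+ (n - k) *: bracket (P k) (M (n - k)).
Proof.
apply: (scalerI w_neq1); rewrite scaler_sumr.
pose f j := if j is k.+1 then if (k <= n)%N then
    (q^-1 * rho q * h) *: bracket (P k) (M (n - k)) else 0 else 0.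
transitivity (\sum_(i < n.+2) w ^+ (n.+1 - i) *: (f i - f i.+1)).
  by apply: eq_bigr => i _; rewrite scalerA mulrC -scalerA ZT_antisym.
rewrite abel_geometric //= ?ltnn //; congr (_ *: _).
rewrite scaler_sumr; apply: eq_bigr => k _.
by rewrite -ltnS ltn_ord subSS !scalerA mulrC.
Qed.

Lemma sum_ZT_bracket n :
  \sum_(i < n.+2) w ^+ (n.+1 - i) *: bracket (Z i) (T (n.+1 - i)) =
  (q^-1 * rho q * h) *:
    \sum_(k < n.+1) w ^+ (n - k) *: (P k * M (n - k) - P (n - k) * M k).
Proof.
apply: (scalerI w_neq1).
pose f i := bracket (Z i) (T (n.+1 - i)).
have bracket_alg c (a : A) : bracket c%:A a = 0.
  by rewrite /bracket mulr_algl mulr_algr subrr.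
have f0 : f 0%N = 0 by rewrite /f Z0 bracket_alg.
have fn : f n.+1 = 0 by rewrite /f ZTC subnn Z0 bracket_alg.
rewrite big_ord_recl big_ord_recr /= -/(f _) -/(f _) f0 fn !scaler0 addr0 add0r.
(* Abel summation is read from right to left: the brackets are the summed values, and [PM_antisym]
   supplies their differences. *)
transitivity (w *: \sum_(k < n.+1) w ^+ (n - k) *: (f k - f k.+1)).
  rewrite abel_geometric // scalerA mulrC -scalerA; congr (_ *: _).
  rewrite scaler_sumr; apply: eq_bigr => k _; rewrite scalerA -exprS.
  by rewrite /bump leq0n add1n subSS subnSK.
rewrite scalerA !scaler_sumr; apply: eq_bigr => k _.
have -> : f k - f k.+1 =
    bracket (Z k) (T (n - k).+1) - bracket (Z k.+1) (T (n - k)).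
  by rewrite /f subSS subSn // -ltnS.
transitivity (w ^+ (n - k) *: (w *: (bracket (Z k) (T (n - k).+1)
    - bracket (Z k.+1) (T (n - k))))); first by rewrite !scalerA mulrC.
by rewrite -PM_antisym !scalerA; congr (_ *: _); ring.
Qed.

(** With [j = n.+1 - i], [Z i T j - T i Z j = (Z i T j - Z j T i) + [Z j, T i]], and the bracket is
    [[Z i, T j]] by [ZTC]. The two preceding sums evaluate these parts, and [PMC] recombines the
    results. *)
Lemma half_determinants_eq n :
  (q^-1 * rho q * h) *:
    \sum_(k < n.+1) w ^+ (n - k) *: (P k * M (n - k) - M k * P (n - k)) =
  \sum_(i < n.+2) w ^+ (n.+1 - i) *: (Z i * T (n.+1 - i) - T i * Z (n.+1 - i)).
Proof.
rewrite [RHS](eq_bigr (fun i : 'I__ =>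
  w ^+ (n.+1 - i) *: (Z i * T (n.+1 - i) - Z (n.+1 - i) * T i) +
  w ^+ (n.+1 - i) *: bracket (Z i) (T (n.+1 - i)))); last first.
  by move=> i _; rewrite -scalerDr (ZTC i) /bracket addrA subrK.
rewrite big_split /= sum_ZT_antisym sum_ZT_bracket -scalerDr -big_split /=.
congr (_ *: _); apply: eq_bigr => k _; rewrite -scalerDr (PMC k) /bracket.
by congr (_ *: _); lin_module K; ring.
Qed.

End HalfDeterminants.

(** * The defining relations inside the quotient algebra *)

Section Center.
Context {K : fieldType} (q : K).

(** The relations use only operations that [f] preserves; this lifts them to the free algebra, where
    [quot_pi_rel] identifies both sides. *)
Lemma UqT_rel_morph (A B : algType K) (f : A -> B) (Yp Ym Z Zt : nat -> A) u v :
    {morph f : x y / x + y} -> {morph f : x y / x - y} -> f 0 = 0 ->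
    (forall c, {morph f : x / c *: x}) -> {morph f : x y / x * y} ->
    UqT_rel q (f \o Yp) (f \o Ym) (f \o Z) (f \o Zt) u v ->
  exists x y, [/\ UqT_rel q Yp Ym Z Zt x y, u = f x & v = f y].
Proof.
move=> fD fB f0 fZ fM.
have fb a b : bracket (f a) (f b) = f (bracket a b) by rewrite fB !fM.
have fqb a b : qbracket q (f a) (f b) = f (qbracket q a b).
  by rewrite fB !fZ !fM.
case=> *; rewrite /= ?fb ?fqb -?fB -?fZ -?fD;
  by do 2!eexists; split; [constructor|reflexivity|rewrite ?f0].
Qed.

Lemma UqT_relP (x y : UqT q) :
  UqT_rel q (@Ypos K q) (@Yneg K q) (@Zgen K q) (@Ztgen K q) x y -> x = y.
Proof.
move=> /(UqT_rel_morph (f := quot_pi (@free_rel_proper K q))).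
case=> [|||||u [v [uv -> ->]]]; last exact: quot_pi_rel uv.
- exact: quot_piD.
- exact: quot_pi_zmod_morphism.
- exact: raddf0.
- exact: quot_piZ.
- exact: quot_piM.
Qed.

Local Notation h := (q + q^-1).
Local Notation w := (q ^- 2).
Hypotheses (q_neq0 : q != 0) (h_neq0 : h != 0) (qm_neq0 : q - q^-1 != 0).

(* Stated for an arbitrary algebra, since conversion is slow in [UqT]. *)
Lemma UqT_rel_halves (A : algType K) (Yp Ym Z Zt : nat -> A)
    (full := fun (x : nat -> A) k =>
       if k is k'.+1 then x k' else (rho q / (q - q^-1))%:A) n :
  (forall x y, UqT_rel q Yp Ym Z Zt x y -> x = y) ->
  (q^-1 * rho q * h) *:
    (\sum_(k < n.+1) w ^+ (n - k) *: (Yp k * Ym (n - k)%N) -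
     \sum_(k < n.+1) w ^+ (n - k) *: (Ym k * Yp (n - k)%N)) =
  \sum_(i < n.+2) w ^+ (n.+1 - i) *: (full Z i * full Zt (n.+1 - i)%N) -
  \sum_(i < n.+2) w ^+ (n.+1 - i) *: (full Zt i * full Z (n.+1 - i)%N).
Proof.
move=> relP.
have bracket0 (c : K) (a : A) : bracket c%:A a = 0.
  by rewrite /bracket mulr_algl mulr_algr subrr.
have bracketC (a b : A) : bracket a b = - bracket b a by rewrite /bracket opprB.
have symE (a b c d : A) :
    bracket a b + bracket c d = 0 -> bracket a b = bracket d c.
  by move=> /eqP; rewrite addr_eq0 => /eqP ->; rewrite -bracketC.
(* The [q]-bracket with the scalar [Z^+_0] is multiplication by [rho]: this is the index 0 case of
   the relations with [Zt]. *)
have scalarE : q * (rho q / (q - q^-1)) - q^-1 * (rho q / (q - q^-1)) = rho q.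
  by rewrite -mulrBl mulrCA mulfV ?mulr1.
rewrite -!sumrB; under eq_bigr do rewrite -scalerBr.
under [RHS]eq_bigr do rewrite -scalerBr.
apply: (half_determinants_eq (D := fun k => h^-1 *: (Z k - Zt k))) => //.
- move=> [|k] /=; last exact/relP/UqT_rel2a.
  by rewrite /qbracket mulr_algr mulr_algl !scalerA -scalerBl scalarE.
- move=> [|k] /=; last exact/relP/UqT_rel3a.
  by rewrite /qbracket mulr_algr mulr_algl !scalerA -scalerBl scalarE.
- by move=> k; exact/relP/UqT_rel1b.
- by move=> k; exact/relP/UqT_rel1a.
- by move=> k l; apply: symE; exact/relP/UqT_rel5.
- by move=> k l; apply: symE; exact/relP/UqT_rel6.
- move=> [|k] [|l] //=; rewrite ?mulr_algl ?mulr_algr //.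
  by apply/eqP; rewrite -subr_eq0; apply/eqP/relP/UqT_rel10a.
- move=> [|k] [|l] //=; rewrite ?bracket0 //.
  + by rewrite bracketC bracket0 oppr0.
  + by rewrite bracketC bracket0 oppr0.
  by apply: symE; exact/relP/UqT_rel11.
Qed.

Lemma UqT_halves n :
  (q^-1 * rho q * h) *:
    (\sum_(k < n.+1) w ^+ (n - k) *: (Ypos q k * Yneg q (n - k)) -
     \sum_(k < n.+1) w ^+ (n - k) *: (Yneg q k * Ypos q (n - k))) =
  \sum_(i < n.+2) w ^+ (n.+1 - i) *: (Zfull q i * Ztfull q (n.+1 - i)) -
  \sum_(i < n.+2) w ^+ (n.+1 - i) *: (Ztfull q i * Zfull q (n.+1 - i)).
Proof. exact: (UqT_rel_halves n UqT_relP). Qed.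
End Center.

(** * Generated subalgebras *)

Section SubalgGen.
Context {K : fieldType} {A : algType K}.
Implicit Types S T : set A.

Lemma subalg_gen_closed S : GRing.subalg_closed [in subalg_gen S].
Proof.
split=> [|c x y /set_mem xS /set_mem yS|x y /set_mem xS /set_mem yS];
  apply/mem_set => B BS; have [[B1 Blin BM] _] := BS; apply: set_mem.
- exact: B1.
- by apply: Blin; apply: mem_set; [exact: xS|exact: yS].
- by apply: BM; apply: mem_set; [exact: xS|exact: yS].
Qed.

Lemma subalg_gen_min S T :
  S `<=` subalg_gen T -> subalg_gen S `<=` subalg_gen T.
Proof. by apply: smallest_sub; exact: subalg_gen_closed. Qed.

Lemma subalg_genZ S c x : subalg_gen S x -> subalg_gen S (c *: x).
Proof.
move=> xS; have [S1 Slin _] := subalg_gen_closed S.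
have S0 : 0 \in subalg_gen S.
  by have := Slin (-1) 1 1 S1 S1; rewrite scaleN1r addNr.
by have := Slin c x 0 (mem_set xS) S0; rewrite addr0 => /set_mem.
Qed.

Lemma subalg_gen_alg S c : subalg_gen S c%:A.
Proof. by apply: subalg_genZ; have [/set_mem] := subalg_gen_closed S. Qed.
End SubalgGen.

(** * The coefficients of the quantum determinant *)

Section DeterminantSeries.
Context {K : fieldType} {A : algType K} (q c zeta bet gam : K).
Hypothesis q_neq0 : q != 0.
Local Notation w := (q ^- 2).

Lemma exprz_m2M l : q ^ (- 2 * l%:Z) = w ^+ l.
Proof. by rewrite -exprz_exp. Qed.

Definition with_const (x : nat -> A) (k : nat) : A :=
  if k is k'.+1 then x k' else zeta%:A.

Lemma even_series_diag x :
  even_series (-1) (fun k => (q / c ^+ k.+1) *: x k)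
    (q *: (lmono 1 1 * genfun c x) : laurent A).
Proof.
have xS := even_series_uvar (even_series_genfun c x).
apply: even_series_ext (even_seriesZ q xS).
by move=> k; rewrite scalerA.
Qed.

(** Taking the prefactor [b] out of the constant too makes [zeta] the coefficient of index 0, as in
    [Zfull] and [Ztfull]. *)
Lemma even_series_offdiag x b :
  even_series 0 (fun k => (b / c ^+ k) *: with_const x k)
    (b *: genfun c x + (b * zeta)%:A : laurent A).
Proof.
have xS := even_series_shift (d := 0) (even_series_genfun c x).
have bS := even_series_const (A := A) (b * zeta).
apply: even_series_ext (even_seriesD (even_seriesZ b xS) bS).
move=> [|k] /=; last by rewrite scalerA addr0.
by rewrite scaler0 add0r expr0 divr1 scalerA.
Qed.

(** Substituting [q u] in the second factor multiplies its coefficient of index [l] by [q^(-2l)], up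
    to a fixed power of [q], whence the weights. Products of diagonal entries start at [u^-2],
    whence their index shift. *)
Lemma even_series_qdet (P M Z T : nat -> A)
    (a := q *: (lmono 1 1 * genfun c P) : laurent A)
    (d := q *: (lmono 1 1 * genfun c M) : laurent A)
    (b := bet *: genfun c T + (bet * zeta)%:A : laurent A)
    (g := gam *: genfun c Z + (gam * zeta)%:A : laurent A) :
  even_series 0 (fun m => 2^-1 *: (
      (if m is n.+1 then (c ^+ n.+2)^-1 *:
         (\sum_(k < n.+1) w ^+ (n - k) *: (P k * M (n - k)%N) +
          \sum_(k < n.+1) w ^+ (n - k) *: (M k * P (n - k)%N)) else 0) -
      (bet * gam / c ^+ m) *:
        (\sum_(i < m.+1) w ^+ (m - i) *:
           (with_const T i * with_const Z (m - i)%N) +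
         \sum_(i < m.+1) w ^+ (m - i) *:
           (with_const Z i * with_const T (m - i)%N))))
    (2^-1 *: (q^-1 *: (a * lsubst q d + d * lsubst q a)
              - (b * lsubst q g + g * lsubst q b))).
Proof.
have aS : even_series (-1) _ a := even_series_diag P.
have dS : even_series (-1) _ d := even_series_diag M.
have bS : even_series 0 _ b := even_series_offdiag T bet.
have gS : even_series 0 _ g := even_series_offdiag Z gam.
have sub := @even_series_lsubst K A q.
apply: even_series_ext (even_seriesZ 2^-1 (even_seriesB
  (even_series_shift (d := 0) (even_seriesZ q^-1 (even_seriesD
    (even_seriesM aS (sub _ _ _ dS)) (even_seriesM dS (sub _ _ _ aS)))))
  (even_seriesD
    (even_seriesM bS (sub _ _ _ gS)) (even_seriesM gS (sub _ _ _ bS))))).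
have diagE (x y : nat -> A) n :
    q^-1 *: \sum_(k < n.+1) (q / c ^+ k.+1) *: x k *
      (q ^ (-1 - 2 * (n - k)%:Z) *: ((q / c ^+ (n - k).+1) *: y (n - k)%N)) =
    (c ^+ n.+2)^-1 *: \sum_(k < n.+1) w ^+ (n - k) *: (x k * y (n - k)%N).
  rewrite !scaler_sumr; apply: eq_bigr => k _.
  rewrite -!(scalerAl, scalerAr) !scalerA; congr (_ *: _).
  rewrite expfzDr // -mulNr exprz_m2M.
  have -> : n.+2 = (k.+1 + (n - k).+1)%N by move: (ltn_ord k); lia.
  rewrite exprD [(_ * c ^+ _)^-1]invfM exprN1.
  move: (c ^+ k.+1)^-1 (c ^+ (n - k).+1)^-1 (w ^+ (n - k)) => c1 c2 wn.
  by field.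
have offE (x y : nat -> A) e f m :
    \sum_(k < m.+1) (e / c ^+ k) *: x k *
      (q ^ (0 - 2 * (m - k)%:Z) *: ((f / c ^+ (m - k)) *: y (m - k)%N)) =
    (e * f / c ^+ m) *: \sum_(k < m.+1) w ^+ (m - k) *: (x k * y (m - k)%N).
  rewrite !scaler_sumr; apply: eq_bigr => k _.
  rewrite -!(scalerAl, scalerAr) !scalerA; congr (_ *: _).
  rewrite sub0r -mulNr exprz_m2M.
  have -> : c ^+ m = c ^+ k * c ^+ (m - k) by rewrite -exprD subnKC // -ltnS.
  rewrite [(_ * c ^+ _)^-1]invfM; ring.
move=> m; congr (_ *: (_ - _)).
  by case: m => // n; rewrite scalerDr !diagE scalerDr.
by rewrite !offE (mulrC gam) scalerDr.
Qed.
End DeterminantSeries.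

(** * Comparison of the coefficients of [Gamma] with the elements [C_(n+1)] *)

Section GammaCoefficients.
Context {K : fieldType} (q kp km : K).
Local Notation h := (q + q^-1).
Local Notation w := (q ^- 2).
Hypotheses (q_neq0 : q != 0) (h_neq0 : h != 0) (qm_neq0 : q - q^-1 != 0).
Hypothesis two_neq0 : 2 != 0 :> K.
Hypothesis Hk : rho q = kp * km * h ^+ 2.

(** By [Hk] each constant in [Kop] is the prefactor of its generating function times
    [rho / (q - q^-1)], the form that [even_series_qdet] expects. *)
Lemma GammaE (A := UqT q) (b0 := rho q / (q - q^-1)) :
  let a := q *: (lmono 1 1 * genfun (Uc q) (@Ypos K q)) : laurent A in
  let d := q *: (lmono 1 1 * genfun (Uc q) (@Yneg K q)) : laurent A in
  let b := (km * h)^-1 *: genfun (Uc q) (@Ztgen K q)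
           + ((km * h)^-1 * b0)%:A : laurent A in
  let g := (kp * h)^-1 *: genfun (Uc q) (@Zgen K q)
           + ((kp * h)^-1 * b0)%:A : laurent A in
  Gamma q kp km = 2^-1 *: (q^-1 *: (a * lsubst q d + d * lsubst q a)
                           - (b * lsubst q g + g * lsubst q b)).
Proof.
have [kp0 km0] : kp != 0 /\ km != 0.
  have := rho_neq0 q_neq0 h_neq0 qm_neq0.
  by rewrite Hk !mulf_eq0 !negb_or => /andP[/andP[]].
have -> : (km * h)^-1 * b0 = kp * h / (q - q^-1).
  by rewrite /b0 Hk; field; rewrite km0 q_neq0 sqr_sub1_neq0 ?sqr_add1_neq0.
have -> : (kp * h)^-1 * b0 = km * h / (q - q^-1).
  by rewrite /b0 Hk; field; rewrite kp0 q_neq0 sqr_sub1_neq0 ?sqr_add1_neq0.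
rewrite /Gamma qdet_trace /Kop_shift ![map_mx _ _ _ _]mxE.
by rewrite ![Kop _ _ _ _ _]mxE.
Qed.

Lemma Gamma_coef_even : even_series 0 (fun m => 2^-1 *: (
    (if m is n.+1 then (Uc q ^+ n.+2)^-1 *:
       (\sum_(k < n.+1) w ^+ (n - k) *: (Ypos q k * Yneg q (n - k)%N) +
        \sum_(k < n.+1) w ^+ (n - k) *: (Yneg q k * Ypos q (n - k)%N)) else 0) -
    ((rho q)^-1 / Uc q ^+ m) *:
      (\sum_(i < m.+1) w ^+ (m - i) *: (Ztfull q i * Zfull q (m - i)%N) +
       \sum_(i < m.+1) w ^+ (m - i) *: (Zfull q i * Ztfull q (m - i)%N))))
  (Gamma q kp km).
Proof.
have -> : (rho q)^-1 = (km * h)^-1 * (kp * h)^-1.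
  by rewrite Hk -invfM; congr (_^-1); ring.
rewrite GammaE.
exact: (even_series_qdet (Uc q) (rho q / (q - q^-1)) (km * h)^-1 (kp * h)^-1
  q_neq0 (@Ypos K q) (@Yneg K q) (@Zgen K q) (@Ztgen K q)).
Qed.

Lemma sum_Y_exponents (V : lmodType K) n (v : nat -> V) :
  \sum_(k < n.+1) q ^ (- 2 * n%:Z + 2 * k%:Z - 1) *: v k =
  q^-1 *: \sum_(k < n.+1) w ^+ (n - k) *: v k.
Proof.
rewrite scaler_sumr; apply: eq_bigr => k _; rewrite scalerA; congr (_ *: _).
rewrite -exprz_m2M -exprN1 -expfzDr //; congr (q ^ _).
by move: (ltn_ord k); lia.
Qed.

Lemma sum_Z_exponents (V : lmodType K) n (v : nat -> V) :
  \sum_(k < n.+2) q ^ (2 * k%:Z - 2 * n%:Z - 2) *: v k =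
  \sum_(k < n.+2) w ^+ (n.+1 - k) *: v k.
Proof.
apply: eq_bigr => k _; congr (_ *: _).
by rewrite -exprz_m2M; congr (q ^ _); move: (ltn_ord k); lia.
Qed.

Lemma central_eltE n :
  central_elt q n = (q ^+ 2 - q ^- 2) *: (q^-1 *:
    \sum_(k < n.+1) w ^+ (n - k) *: (Ypos q k * Yneg q (n - k)%N)) -
  ((q - q^-1) / rho q) *:
    \sum_(i < n.+2) w ^+ (n.+1 - i) *: (Zfull q i * Ztfull q (n.+1 - i)%N).
Proof.
exact: (f_equal2 (fun x y => (q ^+ 2 - q ^- 2) *: x - ((q - q^-1) / rho q) *: y)
  (sum_Y_exponents n (fun k => Ypos q k * Yneg q (n - k)%N))
  (sum_Z_exponents n (fun k => Zfull q k * Ztfull q (n.+1 - k)%N))).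
Qed.

(** The hypothesis expresses [D = D']; its multiple by [- (2 rho c)^-1] removes [y'] and [z'] from
    the half-sum, leaving [D]. It is applied with [c = Uc^(n+1)]. *)
Lemma combine_halves (V : lmodType K) (c : K) (y y' z z' : V) :
  c != 0 -> rho q != 0 ->
  (q^-1 * rho q * h) *: (y - y') = z - z' ->
  2^-1 *: (((c * Uc q)^-1) *: (y + y') - ((rho q)^-1 / c) *: (z' + z)) =
  (c^-1 / (q - q^-1)) *:
    ((q ^+ 2 - q ^- 2) *: (q^-1 *: y) - ((q - q^-1) / rho q) *: z).
Proof.
move=> c0 r0 /(congr1 ( *:%R (- (2 * rho q * c)^-1))) /eq_by_sub; apply.
rewrite /Uc; lin_module K; field.
all: by rewrite c0 r0 two_neq0 q_neq0 sqr_sub1_neq0 ?sqr_add1_neq0.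
Qed.

Lemma Gamma_coef_central n :
  Gamma q kp km (- 2 * n.+1%:Z) =
  ((Uc q ^+ n.+1)^-1 / (q - q^-1)) *: central_elt q n.
Proof.
have [Gn _] := Gamma_coef_even; have := Gn n.+1.
rewrite sub0r -mulNr => ->; rewrite central_eltE exprSr.
apply: combine_halves; first by rewrite expf_neq0 ?mulf_neq0 ?invr_eq0.
  exact: rho_neq0.
exact: UqT_halves.
Qed.

(** At [u^0] only products of the scalars [Z^+_0] and [Zt^+_0] occur, and the other exponents lie
    outside the support. Scalars belong to every unital subalgebra. *)
Lemma Gamma_coef_scalar m : (forall n : nat, m != - 2 * n.+1%:Z) ->
  exists c, Gamma q kp km m = c%:A.
Proof.
have scalarE (A : algType K) (x y : nat -> A) (r s : K) :
    x 0 = s%:A -> y 0 = s%:A -> exists c, 2^-1 *: (0 - r *: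
      (\sum_(i < 1) w ^+ (0 - i) *: (x i * y (0 - i)%N) +
       \sum_(i < 1) w ^+ (0 - i) *: (y i * x (0 - i)%N))) = c%:A.
  move=> x0 y0; exists (2^-1 * - (r * (s * s + s * s))).
  rewrite !big_ord1 /= x0 y0 mulr_algl expr0 !scale1r !scalerA.
  by lin_module K; ring.
have [G0 Gm] := Gamma_coef_even => mE.
have [->|m0] := eqVneq m (0 - 2 * 0%:Z).
  by rewrite G0; apply: (scalarE _ _ _ _ (rho q / (q - q^-1))).
exists 0; rewrite Gm ?scale0r // => -[//|k].
by move: (mE k); rewrite sub0r mulNr.
Qed.

Lemma Gamma_generates : subalg_gen (range (Gamma q kp km)) = center_UqT q.
Proof.
have Uc0 n : Uc q ^+ n != 0 by rewrite expf_neq0 ?mulf_neq0 ?invr_eq0.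
apply/seteqP; split; apply: subalg_gen_min => _ [m _ <-].
  have [[n ->]|mE] := pselect (exists n : nat, m = - 2 * n.+1%:Z).
    rewrite Gamma_coef_central; apply: subalg_genZ.
    by apply: sub_gen_smallest; exists n.
  have [|c ->] := Gamma_coef_scalar (m := m); last exact: subalg_gen_alg.
  by move=> n; apply/eqP => mn; apply: mE; exists n.
rewrite -[central_elt q m](scalerK (a := (Uc q ^+ m.+1)^-1 / (q - q^-1))).
  rewrite -Gamma_coef_central; apply: subalg_genZ.
  by apply: sub_gen_smallest; exists (- 2 * m.+1%:Z).
by rewrite mulf_neq0 ?invr_eq0.
Qed.

End GammaCoefficients.

(** * Non-vanishing of [q] and [q ± q^-1] for rational functions *)

Section RationalFunctionField.
Context (F : fieldType).
Local Notation q := (tofrac 'X : {fraction {poly F}}).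

Lemma fracX_neq0 : q != 0.
Proof. by rewrite tofrac_eq0 polyX_eq0. Qed.

(** [X^2 + c] has size 3, hence is non-zero; [c = 1] and [c = -1] give the numerators of [q + q^-1]
    and [q - q^-1]. *)
Lemma fracX_sqrD_neq0 (c : F) : q ^+ 2 + tofrac c%:P != 0.
Proof.
rewrite -tofracXn -tofracD tofrac_eq0 -size_poly_eq0.
by rewrite size_polyDl ?size_polyXn // (leq_ltn_trans (size_polyC_leq1 _)).
Qed.

Lemma fracX_DV_neq0 : q + q^-1 != 0.
Proof.
have -> : q + q^-1 = (q ^+ 2 + tofrac 1%:P) / q.
  by rewrite polyC1 tofrac1 mulrDl expr2 mulfK ?fracX_neq0 // mul1r.
by apply: mulf_neq0; [exact: fracX_sqrD_neq0|rewrite invr_eq0 fracX_neq0].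
Qed.

Lemma fracX_BV_neq0 : q - q^-1 != 0.
Proof.
have -> : q - q^-1 = (q ^+ 2 + tofrac (-1)%:P) / q.
  rewrite polyCN polyC1 tofracN tofrac1 mulrBl expr2 mulfK ?fracX_neq0 //.
  by rewrite mul1r.
by apply: mulf_neq0; [exact: fracX_sqrD_neq0|rewrite invr_eq0 fracX_neq0].
Qed.

Lemma fracX_nat_neq0 n : n%:R != 0 :> F -> n%:R != 0 :> {fraction {poly F}}.
Proof. by rewrite -tofrac1 -tofracMn tofrac_eq0 -polyC_natr polyC_eq0. Qed.
End RationalFunctionField.

Theorem proposition4p4 (R : realType) (kp km : Cq R)
    (Hk : rho (qvar R) = kp * km * (qvar R + (qvar R)^-1) ^+ 2) :
  subalg_gen (range (lcoef (Gamma (qvar R) kp km))) = center_UqT (qvar R).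
Proof.
have two_neq0 : 2 != 0 :> R[i] by rewrite pnatr_eq0.
exact: (Gamma_generates (fracX_neq0 R[i]) (fracX_DV_neq0 R[i])
  (fracX_BV_neq0 R[i]) (fracX_nat_neq0 two_neq0) Hk).
Qed.
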